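(* Let $b,d\ge2$ and $n\ge1$ be integers with $\gcd(b,d)=1$ and $d\mid(n+1)$, and let $\omega$ be a primitive $d$th root of unity. Let $(\delta_0,\ldots,\delta_{d-1})$ be the permutation of $(0,\ldots,d-1)$ defined by $\delta_rb\equiv r \pmod d$, let $(\beta_0,\ldots,\beta_{b-1})$ be the permutation of $(0,\ldots,b-1)$ defined by $\beta_rd\equiv r\pmod b$, and for $r\in\{0,\ldots,d-1\}$ let $\gamma_r:=(\delta_rb-r)/d$. Then for every $r\in\{0,\ldots,d-1\}$ we have $$\sum_{k\ge0}\omega^{r+dk}\genfrac{[}{]}{0pt}{}{n}{r+dk}_\omega^{(b)}t^{r+dk}=t^r g_r(t^d),$$ where $$g_r(t)=\begin{cases}t^{\gamma_r}\,[\beta_1]_t\,[b]_t^{(n+1)/d-1} & \text{if }\delta_r<\delta_1,\\[2pt] -t^{\gamma_r-b+\beta_1}\,[b-\beta_1]_t\,[b]_t^{(n+1)/d-1} & \text{if }\delta_r\ge\delta_1.\end{cases}$$ Each $g_r(t)$ is plus or minus a unimodal polynomial.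
   Context: $t$ is an indeterminate and $[m]_x:=1+x+\cdots+x^{m-1}$. The polynomials $\genfrac{[}{]}{0pt}{}{n}{k}_q^{(b)}\in\mathbb{N}[q]$ are defined by $$\sum_{k}\genfrac{[}{]}{0pt}{}{n}{k}_q^{(b)}t^k=\prod_{i=0}^{n-1}\left(1+q^it+\cdots+(q^it)^{b-1}\right)$$ (and are $0$ for $k$ outside the range of exponents occurring); $\genfrac{[}{]}{0pt}{}{n}{k}_\omega^{(b)}$ is the evaluation at $q=\omega$. A polynomial $\sum_i c_it^i$ with nonnegative coefficients is unimodal if its coefficient sequence weakly increases and then weakly decreases. *)

(* Defs.v *)
From HB Require Import structures.
From mathcomp Require Import all_boot all_order fingroup perm all_algebra.

Set Implicit Arguments.
Unset Strict Implicit.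
Unset Printing Implicit Defensive.

Import Order.TTheory GRing.Theory Num.Theory.
Local Open Scope ring_scope.

(* [m]_x *)
Definition qnum (S : nzSemiRingType) (m : nat) (x : S) : S :=
  \sum_(i < m) x ^+ i.

(* Polynomials in t (the outer 'X) with coefficients in N[q] (q is the inner
   'X); the factor 1 + q^i t + ... + (q^i t)^(b-1) is [b]_(q^i t). *)
Definition qmulti_gen (b n : nat) : {poly {poly nat}} :=
  \prod_(i < n) qnum b (('X^i)%:P * 'X).

Definition qmulti (b n k : nat) : {poly nat} := (qmulti_gen b n)`_k.

(* The value of p in N[q] at q = x. *)
Definition evalN (S : nzSemiRingType) (p : {poly nat}) (x : S) : S :=
  (map_poly (fun c : nat => c%:R : S) p).[x].

(* The coefficient sequence is padded with zeros, which is harmless since the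
   coefficients are required to be nonnegative. *)
Definition unimodal (p : {poly int}) : Prop :=
  (forall i, 0 <= p`_i) /\
  exists m : nat,
    (forall i j : nat, (i <= j <= m)%N -> p`_i <= p`_j) /\
    (forall i j : nat, (m <= i <= j)%N -> p`_j <= p`_i).

(* Existence and uniqueness of the permutation (delta_0, ..., delta_(d-1)) with
   delta_r b = r mod d; exchanging b and d gives (beta_0, ..., beta_(b-1)). *)
Lemma mulmod_perm_uniq (b d : nat) : coprime b d ->
  exists! s : {perm 'I_d}, forall r : 'I_d, (s r * b = r %[mod d])%N.
Proof.
case: d => [|d] cbd.
  by exists 1%g; split=> [[]//|s _]; apply/permP => -[].
have injf : injective (fun i : 'I_d.+1 => inord (i * b %% d.+1) : 'I_d.+1).
  move=> i j /(congr1 val) /=; rewrite !inordK ?ltn_mod // => /eqP.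
  wlog le_ij : i j / (j <= i)%N => [hw|].
    by case/orP: (leq_total j i) => h /eqP e; [|symmetry]; apply: hw => //; apply/eqP.
  rewrite eqn_mod_dvd ?leq_mul2r ?le_ij ?orbT // -mulnBl.
  rewrite Gauss_dvdl 1?coprime_sym // -eqn_mod_dvd // !modn_small //.
  by move=> /eqP/val_inj.
exists (perm injf)^-1%g; split=> [r|s hs].
  have := congr1 val (permKV (perm injf) r); rewrite permE /= inordK ?ltn_mod //.
  by move=> ->; rewrite modn_small.
apply/permP => r; apply: (@perm_inj _ (perm injf)).
rewrite permKV permE; apply/val_inj; rewrite /= inordK ?ltn_mod //.
by rewrite hs modn_small.
Qed.

(* In natural numbers, the subtractions in gamma_r = (delta_r b - r) / d and in
   gamma_r + beta_1 - b (when delta_1 <= delta_r) do not truncate; in the next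
   two lemmas s is delta_r. *)
Lemma leq_mulmod (b d s r : nat) :
  (r < d -> s * b = r %[mod d] -> r <= s * b)%N.
Proof. by move=> ltrd; rewrite (modn_small ltrd) => <-; apply: leq_mod. Qed.

Lemma gamma_beta_geq (b d r s delta1 beta1 : nat) :
  coprime b d -> (1 < b)%N -> (1 < d)%N -> (r < d)%N ->
  (delta1 < d)%N -> (delta1 * b = 1 %[mod d])%N ->
  (beta1 < b)%N -> (beta1 * d = 1 %[mod b])%N ->
  (s * b = r %[mod d])%N -> (delta1 <= s)%N ->
  (b <= (s * b - r) %/ d + beta1)%N.
Proof.
move=> cbd b1 d1 rd dd hd bb hb hs le1.
have hX : (delta1 * b + beta1 * d = 1 %[mod b * d])%N.
  apply/eqP; rewrite chinese_remainder //; apply/andP; split; apply/eqP.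
    by rewrite modnMDl.
  by rewrite addnC modnMDl.
have delta1_gt0 : (0 < delta1)%N.
  by case: (posnP delta1) hd => // ->; rewrite mul0n mod0n modn_small.
have beta1_gt0 : (0 < beta1)%N.
  by case: (posnP beta1) hb => // ->; rewrite mul0n mod0n modn_small.
have bd1 : (1 < b * d)%N by rewrite (leq_trans b1) // leq_pmulr // ltnW.
rewrite (modn_small bd1) in hX.
have eX := divn_eq (delta1 * b + beta1 * d) (b * d); rewrite hX in eX.
have q0 : (0 < (delta1 * b + beta1 * d) %/ (b * d))%N.
  rewrite lt0n; apply/eqP => q0; rewrite q0 mul0n add0n in eX.
  have : (1 + 1 <= delta1 * b + beta1 * d)%N.
    by rewrite leq_add // muln_gt0 ?delta1_gt0 ?beta1_gt0 /=; apply: ltnW.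
  by rewrite eX.
have geX : (b * d + 1 <= delta1 * b + beta1 * d)%N.
  by rewrite eX leq_add2r leq_pmull.
have ers : ((s * b - r) = (s * b - r) %/ d * d)%N.
  rewrite divnK // -eqn_mod_dvd; first by apply/eqP.
  exact: leq_mulmod hs.
have := leq_mulmod rd hs.
move: ers; set g := (_ %/ _)%N => ers lers.
have hs1 : (delta1 * b <= s * b)%N by rewrite leq_mul2r le1 orbT.
have key : (b * d + 1 <= r + (g + beta1) * d)%N.
  rewrite mulnDl -ers addnA subnKC //.
  by rewrite (leq_trans geX) // leq_add2r.
rewrite leqNgt; apply/negP => hlt.
have : ((g + beta1).+1 * d <= b * d)%N by rewrite leq_mul2r hlt orbT.
rewrite mulSn => h2; have := leq_trans (leq_add (leqnn d) key) (eq_leq (addnCA _ _ _)).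
move=> h3; have := leq_trans h3 (leq_add (leqnn r) h2).
rewrite addn1 addnS addnC [(r + _)%N]addnC.
by rewrite -addnS leq_add2l ltnNge (ltnW rd).
Qed.

(* Main.v *)
(** Substituting [t -> omega t] turns the generating product into
[P = prod_(1 <= i <= n) [b]_(omega^i t)]. Since [gcd(b, d) = 1], one full period
[prod_(i < d) [b]_(omega^i t)] equals [[b]_(t^d)], and [d] divides [n + 1], so
[[b]_t P = [b]_(t^d)^((n+1)/d)], that is [P = Q [b]_(t^d)^((n+1)/d-1)] with
[Q = [b]_(t^d) / [b]_t = (1 - t) [d]_(t^b) / (1 - t^d)]. The exponents [s b],
[s < d], of [[d]_(t^b)] represent every residue mod [d] exactly once; those of
[t [d]_(t^b)] are, by [delta_1 b + beta_1 d = b d + 1], the same exponents shifted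
by [beta_1 d] (if [s < delta_1]) or by [(beta_1 - b) d] (otherwise). Hence the
part of [Q] in each residue class is a signed block of consecutive powers of [t^d].
Unimodality holds because products of blocks [[m]_t] are sums of blocks with a
common centre, by [[m+1][l+1] = [m+l+1] + t [m][l]]. *)

From HB Require Import structures.
Require Import Defs.
From mathcomp Require Import all_boot all_order fingroup perm all_algebra.
From mathcomp Require Import zify ring.

Set Implicit Arguments.
Unset Strict Implicit.
Unset Printing Implicit Defensive.

Import Order.TTheory GRing.Theory Num.Theory.
Local Open Scope ring_scope.

(** * Identities for the blocks [[m]_x] *)

Lemma qnum0 (R : nzSemiRingType) (x : R) : qnum 0 x = 0.
Proof. by rewrite /qnum big_ord0. Qed.

Lemma qnumSr (R : nzSemiRingType) m (x : R) : qnum m.+1 x = qnum m x + x ^+ m.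
Proof. by rewrite /qnum big_ord_recr. Qed.

Lemma qnumSl (R : nzSemiRingType) m (x : R) : qnum m.+1 x = 1 + x * qnum m x.
Proof.
rewrite /qnum big_ord_recl expr0 mulr_sumr; congr (_ + _).
by apply: eq_bigr => i _; rewrite -exprS.
Qed.

Lemma mul_subr_qnum (R : nzRingType) m (x : R) : (1 - x) * qnum m x = 1 - x ^+ m.
Proof. by rewrite -[LHS]opprK -mulNr !opprB -subrX1 opprB. Qed.

Lemma qnum_morph (R S : nzSemiRingType) (f : {rmorphism R -> S}) m x :
  f (qnum m x) = qnum m (f x).
Proof. by rewrite /qnum rmorph_sum; apply: eq_bigr => i _; rewrite rmorphXn. Qed.

Lemma qnum_mulSS (R : comNzRingType) m l (x : R) :
  qnum m.+1 x * qnum l.+1 x = qnum (m + l).+1 x + x * (qnum m x * qnum l x).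
Proof.
elim: m => [|m IH]; first by rewrite !qnumSl qnum0; ring.
rewrite qnumSr mulrDl {}IH addSn (qnumSr (m + l).+1) (qnumSr m) (qnumSr l).
by rewrite -addnS exprD !exprS; ring.
Qed.

Lemma coef_Xn_qnum (R : nzRingType) k l i :
  ('X^k * qnum l 'X : {poly R})`_i = (k <= i < k + l)%N%:R.
Proof.
rewrite coefXnM /qnum.
have -> : \sum_(j < l) 'X^j = \poly_(j < l) (1 : R).
  by rewrite poly_def; apply: eq_bigr => j _; rewrite scale1r.
rewrite coef_poly; case: ltnP => //= h.
by rewrite ltn_subLR //; case: ifP.
Qed.

(** * Unimodality of products of blocks *)

(* Cone spanned by the blocks of ones [X^k + ... + X^(k+l-1)] sharing the centre
   [(s - 1) / 2]. *)
Inductive centered (s : nat) : {poly int} -> Prop :=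
| centered0 : centered s 0
| centered_block k l : (k + k + l)%N = s -> centered s ('X^k * qnum l 'X)
| centeredD p q : centered s p -> centered s q -> centered s (p + q).

Lemma centered_Xn s k p : centered s p -> centered (k + k + s) ('X^k * p).
Proof.
elim=> [|j l <-|p1 p2 _ h1 _ h2].
- by rewrite mulr0; apply: centered0.
- by rewrite mulrA -exprD; apply: centered_block; lia.
- by rewrite mulrDr; apply: centeredD.
Qed.

(** Iterating [qnum_mulSS] peels off the longest block; the remaining [t [m] [l]] has smaller
    factors and the same centre. *)
Lemma centered_qnum_mul m l :
  centered (m + l).+1 (qnum m.+1 'X * qnum l.+1 'X).
Proof.
elim: m l => [|m IH] l; rewrite qnum_mulSS; apply: centeredD.
- by rewrite -[qnum _ _]mul1r; apply: (@centered_block _ 0).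
- by rewrite qnum0 mul0r mulr0; apply: centered0.
- by rewrite -[qnum _ _]mul1r; apply: (@centered_block _ 0).
case: l => [|l]; first by rewrite qnum0 !mulr0; apply: centered0.
by rewrite addSn addnS; apply: (@centered_Xn _ 1) (IH l).
Qed.

Lemma centered_qnumM s m p : centered s p -> centered (s + m) (qnum m.+1 'X * p).
Proof.
elim=> [|j [|l] <-|p1 p2 _ h1 _ h2].
- by rewrite mulr0; apply: centered0.
- by rewrite qnum0 !mulr0; apply: centered0.
- rewrite mulrCA -addnA addSn [(l + m)%N]addnC.
  exact: centered_Xn (centered_qnum_mul m l).
- by rewrite mulrDr; apply: centeredD.
Qed.

Lemma centered_unimodal s p : centered s p -> unimodal p.
Proof.
(* A nonempty block with [k + k + l = s] contains the exponent [(s - 1) / 2] rounded down, so this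
   is a common peak. *)
move=> cp; split; last exists s.-1./2; first move=> i.
- elim: cp => [|k l _|p1 p2 _ h1 _ h2].
  + by rewrite coef0.
  + by rewrite coef_Xn_qnum ler0n.
  + by rewrite coefD addr_ge0.
- split=> i j hij; (elim: cp => [|k l hs|p1 p2 _ h1 _ h2];
   [ by rewrite !coef0
   | rewrite !coef_Xn_qnum ler_nat; lia
   | by rewrite !coefD lerD]).
Qed.

Lemma unimodal_Xn_qnum k m b e :
  unimodal ('X^k * qnum m 'X * qnum b.+1 'X ^+ e).
Proof.
suff [s /centered_unimodal //] :
  exists s, centered s ('X^k * qnum m 'X * qnum b.+1 'X ^+ e).
elim: e => [|e [s IH]].
  by exists (k + k + m)%N; rewrite mulr1; apply: centered_block.
by exists (s + b)%N; rewrite exprS mulrCA; apply: centered_qnumM.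
Qed.

(** * Products over the powers of a root of unity *)

Section Product.

Variables (C : fieldType) (d : nat).

(** The factors vanish at the powers of [z^-1], so the product is [c ('X^d - 1)]; evaluation at [0]
    gives [c = -1]. *)
Lemma prod_1sub_prim_root (z : C) : d.-primitive_root z ->
  \prod_(i < d) (1 - (z ^+ i)%:P * 'X) = 1 - 'X^d.
Proof.
move=> pz; have d0 := prim_order_gt0 pz.
have z0 : z != 0 by rewrite (prim_root_eq0 pz) -lt0n.
have pzV : d.-primitive_root z^-1.
  have -> : z^-1 = z ^+ d.-1.
    by apply: (mulfI z0); rewrite divff // -exprS prednK // (prim_expr_order pz).
  by rewrite prim_root_exp_coprime // coprimePn.
pose c : C := \prod_(i < d) - z ^+ i.
have eqc : \prod_(i < d) (1 - (z ^+ i)%:P * 'X) = c%:P * ('X^d - 1).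
  rewrite -(factor_Xn_sub_1 pzV) big_mkord rmorph_prod -big_split /=.
  apply: eq_bigr => i _; rewrite rmorphN mulNr mulrBr opprB -rmorphM /=.
  by rewrite exprVn divff ?expf_neq0.
rewrite eqc; have := congr1 (horner^~ 0) eqc.
rewrite horner_prod big1 => [|i _]; last by rewrite !hornerE subr0.
rewrite !hornerE expr0n -[d == _]negbK -lt0n d0 /= sub0r mulrN1 => /eqP.
by rewrite eq_sym eqr_oppLR => /eqP ->; rewrite rmorphN1 mulN1r opprB.
Qed.

(** Multiplying each factor by [1 - z^i t] leaves [1 - z^(i b) t^b], and [z^b] is again a primitive
    root, so both sides become [1 - t^(b d)]. *)
Lemma prod_qnum_prim_root (z : C) b : coprime b d -> d.-primitive_root z ->
  \prod_(i < d) qnum b ((z ^+ i)%:P * 'X) = qnum b ('X^d).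
Proof.
move=> cbd pz; have d0 := prim_order_gt0 pz.
have nz : 1 - 'X^d != 0 :> {poly C}.
  by rewrite -oppr_eq0 opprB monic_neq0 ?monicXnsubC.
apply: (mulfI nz).
rewrite mul_subr_qnum -exprM -{1}(prod_1sub_prim_root pz) -big_split /=.
have pzb : d.-primitive_root (z ^+ b) by rewrite prim_root_exp_coprime.
have := congr1 (comp_poly 'X^b) (prod_1sub_prim_root pzb).
rewrite rmorph_prod rmorphB rmorph1 rmorphXn /= comp_polyX -exprM mulnC => <-.
apply: eq_bigr => i _; rewrite mul_subr_qnum rmorphB rmorph1 rmorphM /=.
by rewrite comp_polyC comp_polyX exprMn -rmorphXn /= exprAC.
Qed.

Lemma prod_qnum_prim_root_mul (z : C) b M : coprime b d -> d.-primitive_root z ->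
  \prod_(i < d * M) qnum b ((z ^+ i)%:P * 'X) = qnum b ('X^d) ^+ M.
Proof.
move=> cbd pz; elim: M => [|M IH]; first by rewrite muln0 big_ord0.
rewrite mulnS big_split_ord /= prod_qnum_prim_root // exprS -IH; congr (_ * _).
by apply: eq_bigr => i _; rewrite exprD (prim_expr_order pz) mul1r.
Qed.

End Product.

(** * Splitting [[b]_(t^d) / [b]_t] by residues modulo [d] *)

(** By the Chinese remainder theorem the sum is [1] modulo [b d], and it lies strictly between [1]
    and [2 b d]. *)
Lemma bezout_perm_one (b d delta1 beta1 : nat) :
  coprime b d -> (1 < b)%N -> (1 < d)%N ->
  (delta1 < d)%N -> (delta1 * b = 1 %[mod d])%N ->
  (beta1 < b)%N -> (beta1 * d = 1 %[mod b])%N ->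
  (delta1 * b + beta1 * d = (b * d).+1)%N.
Proof.
move=> cbd b1 d1 dd hd bb hb.
have hX : (delta1 * b + beta1 * d = 1 %[mod b * d])%N.
  apply/eqP; rewrite chinese_remainder //; apply/andP; split; apply/eqP.
    by rewrite modnMDl.
  by rewrite addnC modnMDl.
have D0 : (0 < delta1)%N by case: delta1 hd {dd hX} => //; rewrite mod0n modn_small.
have B0 : (0 < beta1)%N by case: beta1 hb {bb hX} => //; rewrite mod0n modn_small.
have ltD : (delta1 * b < b * d)%N by rewrite mulnC ltn_pmul2l // ltnW.
have ltB : (beta1 * d < b * d)%N by rewrite ltn_pmul2r // ltnW.
have D_gt0 : (0 < delta1 * b)%N by rewrite muln_gt0 D0 ltnW.
have B_gt0 : (0 < beta1 * d)%N by rewrite muln_gt0 B0 ltnW.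
rewrite (@modn_small 1) in hX; last by rewrite (leq_ltn_trans D_gt0).
have := divn_eq (delta1 * b + beta1 * d) (b * d); rewrite hX {hX hd hb cbd}.
by case: (_ %/ _)%N => [|[|q]]; rewrite ?mulSn; lia.
Qed.

(** The relation on [D] and [B] turns the exponents into [1 + b (s + d - D)] for [s < D] and
    [1 + b (s - D)] otherwise: a cyclic rotation of [s]. *)
Lemma sum_rotate_pow (R : comNzRingType) (b d D B : nat) (x : R) :
  (D <= d)%N -> (D * b + B * d = (b * d).+1)%N ->
  \sum_(s < d) (if (s < D)%N then x ^+ (s * b + B * d)
                else x ^+ (s * b + B * d - b * d)) = x * qnum d (x ^+ b).
Proof.
move=> leDd bez.
rewrite -(big_mkord xpredT (fun s => if (s < D)%N then x ^+ (s * b + B * d)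
                else x ^+ (s * b + B * d - b * d))).
rewrite /qnum -(big_mkord xpredT (fun i => (x ^+ b) ^+ i)).
rewrite (big_cat_nat (n := D)) //=.
rewrite [in RHS](big_cat_nat (n := (d - D)%N)) ?leq_subr //=.
rewrite mulrDr addrC !mulr_sumr; congr (_ + _).
  rewrite -{1}[D]add0n big_addn big_nat_cond [RHS]big_nat_cond.
  apply: eq_bigr => i _; rewrite ltnNge leq_addl /= -exprM -exprS; congr (_ ^+ _).
  nia.
rewrite -{1}[(d - D)%N]add0n big_addn subKn // big_nat_cond [RHS]big_nat_cond.
apply: eq_bigr => i /andP[/andP[_ ->] _]; rewrite -exprM -exprS; congr (_ ^+ _).
nia.
Qed.

(* [t^r quot_part(t^d)] with [s = delta_r], [D = delta_1], [B = beta_1] is the part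
   of [[b]_(t^d) / [b]_t] in the residue class of [r] mod [d]. *)
Definition quot_part (R : nzRingType) (b D B s gamma : nat) : {poly R} :=
  if (s < D)%N then 'X^gamma * qnum B 'X
  else - ('X^(gamma + B - b) * qnum (b - B) 'X).

(** Multiplication by [1 - t^d] telescopes the block; the last hypothesis keeps [gamma + B - b] from
    truncating. *)
Lemma quot_part_mul (R : comNzRingType) (b d D B s r gamma : nat) :
  (B <= b)%N -> (r + gamma * d = s * b)%N ->
  ((D <= s)%N -> (b <= gamma + B)%N) ->
  (1 - 'X^d) * ('X^r * (quot_part R b D B s gamma \Po 'X^d))
  = 'X^(s * b) - (if (s < D)%N then 'X^(s * b + B * d)
                else 'X^(s * b + B * d - b * d)).
Proof.
move=> leBb eg le_b; rewrite /quot_part.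
have mulACA (a x y z : {poly R}) : a * (x * (y * z)) = x * y * (a * z) by ring.
case: ltnP => [_|/le_b {}le_b]; rewrite ?rmorphN rmorphM rmorphXn /=;
  rewrite (qnum_morph (comp_poly 'X^d)) /= comp_polyX ?mulrN mulACA mul_subr_qnum.
  by rewrite mulrBr mulr1 -!exprM -!exprD -eg; congr ('X^_ - 'X^_); lia.
rewrite mulrBr mulr1 -!exprM -!exprD opprB; congr ('X^_ - 'X^_); nia.
Qed.

(** As [delta] is a permutation, [s = delta r] runs over all [s < d]; the positive terms give
    [[d]_(t^b)], the negative ones its rotation [t [d]_(t^b)]. *)
Lemma sum_quot_part (R : comNzRingType) (b d D B : nat) (delta : {perm 'I_d})
    (gamma : 'I_d -> nat) :
  (D <= d)%N -> (B <= b)%N -> (D * b + B * d = (b * d).+1)%N ->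
  (forall r : 'I_d, (r + gamma r * d = delta r * b)%N) ->
  (forall r, (D <= delta r)%N -> (b <= gamma r + B)%N) ->
  (1 - 'X^d) * \sum_(r < d) 'X^r * (quot_part R b D B (delta r) (gamma r) \Po 'X^d)
  = (1 - 'X) * qnum d ('X^b).
Proof.
move=> leDd leBb bez eg le_b.
rewrite mulr_sumr (eq_bigr _ (fun r _ => quot_part_mul R leBb (eg r) (@le_b r))).
transitivity (\sum_(s < d) ('X^(s * b) - if (s < D)%N then 'X^(s * b + B * d)
                              else 'X^(s * b + B * d - b * d)) : {poly R}).
  by rewrite [RHS](reindex_perm delta).
rewrite sumrB sum_rotate_pow // mulrBl mul1r; congr (_ - _).
by apply: eq_bigr => i _; rewrite -exprM mulnC.
Qed.

(** * Coefficients in a residue class, and evaluation in [q] *)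

(** Only the summand [s = r] has exponents congruent to [r] modulo [d]. *)
Lemma residue_part (R : comNzRingType) (d K : nat) (G : 'I_d -> {poly R})
    (p : {poly R}) (r : 'I_d) :
  p = \sum_(s < d) 'X^s * (G s \Po 'X^d) -> (size p <= K)%N ->
  \sum_(k < K) p`_(r + d * k) *: 'X^(r + d * k) = 'X^r * (G r \Po 'X^d).
Proof.
move=> defp szp; have d0 : (0 < d)%N by apply: leq_ltn_trans (ltn_ord r).
have coefp k : p`_(r + d * k) = (G r)`_k.
  rewrite defp coef_sum (bigD1 r) //= big1 => [|s nsr].
    rewrite coefXnM ltnNge leq_addr /= addKn coef_comp_poly_Xn //.
    by rewrite dvdn_mulr // mulKn // addr0.
  rewrite coefXnM; case: ltnP => // lesr; rewrite coef_comp_poly_Xn //.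
  case: ifP => //; rewrite -eqn_mod_dvd // addnC mulnC modnMDl !modn_small //.
  by move/eqP/val_inj => e; rewrite e eqxx in nsr.
(* From [K] on the coefficients of [G r] vanish, because [k <= r + d * k]. *)
have -> : G r = \poly_(k < K) p`_(r + d * k).
  apply/polyP => k; rewrite coef_poly -coefp; case: ltnP => // leKk.
  by rewrite nth_default // (leq_trans szp) // (leq_trans leKk) //; nia.
rewrite poly_def rmorph_sum mulr_sumr; apply: eq_bigr => k _ /=.
by rewrite comp_polyZ rmorphXn /= comp_polyX -scalerAr -exprM -exprD.
Qed.

Lemma coef_comp_scaleX (R : comNzRingType) (p : {poly R}) (c : R) k :
  (p \Po (c%:P * 'X))`_k = c ^+ k * p`_k.
Proof.
rewrite comp_polyE (eq_bigr (fun i : 'I_(size p) => (c ^+ i * p`_i) *: 'X^i)).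
  rewrite -(poly_def (size p) (fun i => c ^+ i * p`_i)) coef_poly; case: ltnP => // h.
  by rewrite nth_default ?mulr0.
by move=> i _; rewrite exprMn -rmorphXn mul_polyC scalerA mulrC.
Qed.

(** A named cast, to which morphism structures can be attached. *)
Definition nat_morph (R : nzSemiRingType) (c : nat) : R := c%:R.

HB.instance Definition _ (R : nzSemiRingType) :=
  GRing.isNmodMorphism.Build nat R (@nat_morph R) (conj (erefl 0) (@natrD R)).
HB.instance Definition _ (R : nzSemiRingType) :=
  GRing.isMonoidMorphism.Build nat R (@nat_morph R) (conj (erefl 1) (@natrM R)).

Definition evalN_morph (R : comNzRingType) (x : R) : {rmorphism {poly nat} -> R} :=
  horner_eval x \o map_poly (@nat_morph R).

(** The factor [x ^+ k] amounts to substituting [x t] for [t], which raises the exponent [i] to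
    [i.+1]. *)
Lemma evalN_coef (R : comNzRingType) (b n k : nat) (x : R) :
  x ^+ k * evalN (qmulti b n k) x
  = (\prod_(i < n) qnum b ((x ^+ i.+1)%:P * 'X))`_k.
Proof.
have -> : evalN (qmulti b n k) x = (map_poly (evalN_morph x) (qmulti_gen b n))`_k.
  by rewrite coef_map.
rewrite -coef_comp_scaleX; congr (polyseq _)`_k.
rewrite !rmorph_prod; apply: eq_bigr => i _ /=.
rewrite (qnum_morph (map_poly _)) (qnum_morph (comp_poly _)); congr (qnum _ _).
rewrite rmorphM /= map_polyX map_polyC /= rmorphM /= comp_polyC comp_polyX.
by rewrite mulrA -rmorphM map_polyXn /horner_eval hornerXn -exprSr.
Qed.

Theorem corollary4p5 (C : numClosedFieldType) (b d n : nat)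
    (hb : (2 <= b)%N) (hd : (2 <= d)%N) (hn : (1 <= n)%N)
    (hbd : gcdn b d = 1%N) (hdn : (d %| n.+1)%N)
    (omega : C) (homega : d.-primitive_root omega)
    (delta : {perm 'I_d})
    (hdelta : forall r : 'I_d, (delta r * b = r %[mod d])%N)
    (beta : {perm 'I_b})
    (hbeta : forall r : 'I_b, (beta r * d = r %[mod b])%N) :
  (* hd and hb are the inequalities 1 < d and 1 < b, so these are the index 1 *)
  let one_d : 'I_d := Ordinal hd in
  let one_b : 'I_b := Ordinal hb in
  let beta1 : nat := beta one_b in
  let gamma (r : 'I_d) : nat := ((delta r * b - r) %/ d)%N in
  let e : nat := (n.+1 %/ d - 1)%N in
  let g (r : 'I_d) : {poly int} :=
    if (delta r < delta one_d)%N
    then 'X^(gamma r) * qnum beta1 'X * qnum b 'X ^+ e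
    else - ('X^(gamma r + beta1 - b) * qnum (b - beta1) 'X * qnum b 'X ^+ e) in
  forall r : 'I_d,
    \sum_(k < size (qmulti_gen b n))
        (omega ^+ (r + d * k) * evalN (qmulti b n (r + d * k)) omega)
          *: 'X^(r + d * k)
      = 'X^r * (map_poly intr (g r) \Po 'X^d)
    /\ (unimodal (g r) \/ unimodal (- g r)).
Proof.
move=> one_d one_b beta1 gamma e g r.
have cbd : coprime b d by apply/eqP.
split; last first.
  rewrite /g -(prednK (ltnW hb)); case: ifP => _; [left|right; rewrite opprK];
  exact: unimodal_Xn_qnum.
have hd1 := hdelta one_d; have hb1 := hbeta one_b.
have bez := bezout_perm_one cbd hb hd (ltn_ord _) hd1 (ltn_ord _) hb1.
have eg (s : 'I_d) : (s + gamma s * d = delta s * b)%N.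
  have le_s := leq_mulmod (ltn_ord s) (hdelta s).
  by rewrite divnK ?subnKC // -eqn_mod_dvd //; apply/eqP.
have le_b s : (delta one_d <= delta s)%N -> (b <= gamma s + beta1)%N.
  exact: gamma_beta_geq cbd hb hd (ltn_ord s) (ltn_ord _) hd1 (ltn_ord _) hb1
                        (hdelta s).
pose p := \prod_(i < n) qnum b ((omega ^+ i.+1)%:P * 'X) : {poly C}.
pose h s : {poly C} := quot_part C b (delta one_d) beta1 (delta s) (gamma s).
pose Q := \sum_(s < d) 'X^s * (h s \Po 'X^d).
have gE s : map_poly intr (g s) = h s * qnum b 'X ^+ e.
  rewrite /g /h /quot_part; case: ifP => _;
  by rewrite ?rmorphN /= !rmorphM /= !map_polyXn rmorphXn /=
             !(qnum_morph (map_poly _)) /= !map_polyX ?mulNr.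
(* After multiplication by [1 - t^d] both sides equal [1 - t^(b d)]. *)
have bQ : qnum b 'X * Q = qnum b ('X^d).
  have nz : 1 - 'X^d != 0 :> {poly C}.
    by rewrite -oppr_eq0 opprB monic_neq0 ?monicXnsubC // ltnW.
  have QE : (1 - 'X^d) * Q = (1 - 'X) * qnum d ('X^b).
    exact: sum_quot_part (ltnW (ltn_ord _)) (ltnW (ltn_ord _)) bez eg le_b.
  apply: (mulfI nz); rewrite mulrCA QE mulrCA mulrA !mul_subr_qnum.
  by rewrite -!exprM mulnC.
(* The factor [[b]_t] is the missing one for [i = 0]; it completes [p] to [n + 1] factors, a whole
   number of periods. *)
have bp : qnum b 'X * p = qnum b ('X^d) ^+ (n.+1 %/ d).
  rewrite -(prod_qnum_prim_root_mul _ cbd homega) mulnC divnK // big_ord_recl.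
  by rewrite expr0 mul1r.
have defp : p = Q * qnum b ('X^d) ^+ e.
  (* The constant term is [1], so [[b]_t] can be cancelled. *)
  have nz : qnum b 'X != 0 :> {poly C}.
    apply/eqP => /(congr1 (horner^~ 0))/eqP.
    by rewrite -(prednK (ltnW hb)) qnumSl !hornerE oner_eq0.
  apply: (mulfI nz); rewrite bp mulrA bQ -exprS; congr (_ ^+ _).
  have q_gt0 : (0 < n.+1 %/ d)%N by rewrite divn_gt0 ?(ltnW hd) // dvdn_leq.
  by rewrite -(subnK q_gt0) addn1.
under eq_bigr => k _ do rewrite evalN_coef -/p.
apply: residue_part (fun s => map_poly intr (g s)) _ _ _ _.
  rewrite defp mulr_suml; apply: eq_bigr => s _.
  by rewrite gE rmorphM rmorphXn /= (qnum_morph (comp_poly _)) /= comp_polyX mulrA.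
(* Past the size of [qmulti_gen b n] the coefficient in [N[q]] is zero, hence so is its value at
   [omega]. *)
apply/leq_sizeP => k lek; rewrite -evalN_coef /qmulti nth_default //.
by rewrite /evalN map_poly0 horner0 mulr0.
Qed.
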